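(* Let $I$ be a two-sided ideal of $\mathbb S^{nc}(F)$ that is free of rank 1 on the left and on the right. Then $I$ is generated by a normal family of elements.
   Context: All fields have characteristic $\ne 2$. $F$ is a field and $K_0,K_1\subset F$ are subfields of index 2 such that the $K_0$-$K_1$-bimodule $F$ is simple. Integer subscripts on fields are read modulo 2; $\mathrm{Gal}(F/K_i)=\{1,\tau_i\}$. A $\mathbb Z$-indexed algebra $C$ consists of abelian groups $C_{ij}$ ($i,j\in\mathbb Z$) with associative biadditive multiplications $C_{ij}\times C_{jl}\to C_{il}$ and local units $e_i\in C_{ii}$; it is identified with the ring $\bigoplus_{i,j}C_{ij}$, where the product of $C_{ij}$ and $C_{rl}$ is $0$ for $j\neq r$. Ideals are graded: $I=\bigoplus I_{ij}$, $I_{ij}=e_iIe_j$. Tensor algebra $T=T(F)$: $T_{ij}=0$ for $i>j$, $T_{ii}=K_i$, and for $i<j$, $T_{ij}=F\otimes_{K_{i+1}}F\otimes_{K_{i+2}}\cdots\otimes_{K_{j-1}}F$ ($j-i$ factors), with multiplication given by the tensor product. $\mathbb S^{nc}(F)=T/R$, where $R$ is the two-sided ideal generated by $h_i=1\otimes_{K_{i+1}}1+w_{i+1}^{-1}\otimes_{K_{i+1}}w_{i+1}\in T_{i,i+2}$ $(i\in\mathbb Z)$, with $w_{i+1}\in F\setminus K_{i+1}$, $w_{i+1}^2\in K_{i+1}$ (equivalently $0\ne w_{i+1}$, $\tau_{i+1}(w_{i+1})=-w_{i+1}$). An element $a\in C_{ij}$ is regular (a non-zero-divisor) if $ab\ne0$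 and $ca\neq0$ for all non-zero $b\in e_jC$ and non-zero $c\in Ce_i$. A right ideal $I\subset C$ is free of rank 1 if there is a family of regular elements $\{a_i\in C_{i,i+\delta_i}\}_{i\in\mathbb Z}$ with $e_iI=a_iC$ for all $i$; a left ideal is free of rank 1 if there is a family of regular elements $\{b_j\in C_{j-\varepsilon_j,j}\}_{j\in\mathbb Z}$ with $Ie_j=Cb_j$ for all $j$. A family $x=\{x_i\in C_{i,i+\delta}\}_{i\in\mathbb Z}$ is a normal family of elements of degree $\delta$ if $x_iC_{i+\delta,j+\delta}=C_{ij}x_j$ for all $i,j\in\mathbb Z$. *)

(* Defs.v *)
From HB Require Import structures.
From mathcomp Require Import all_boot all_order all_algebra.
From mathcomp Require Import generic_quotient ring_quotient.
From mathcomp.multinomials Require Import freeg.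
From mathcomp.classical Require Import boolp.
From mathcomp Require Import zify.

Set Implicit Arguments.
Unset Strict Implicit.
Unset Printing Implicit Defensive.

Import GRing.Theory.
Local Open Scope ring_scope.
Local Open Scope quotient_scope.

Section Subfields.
Variable F : fieldType.

Definition index2 (K : divringClosed F) : Prop :=
  exists u v : F, forall x : F,
    exists! kl : F * F, [/\ kl.1 \in K, kl.2 \in K & x = kl.1 * u + kl.2 * v].

Definition simple_bimodule (K0 K1 : divringClosed F) : Prop :=
  forall V : F -> Prop,
    V 0 -> (forall x y, V x -> V y -> V (x - y)) ->
    (forall k x, k \in K0 -> V x -> V (k * x)) ->
    (forall x k, k \in K1 -> V x -> V (x * k)) ->
    (forall x, V x -> x = 0) \/ (forall x, V x).

Definition subfield_mod2 (K0 K1 : divringClosed F) (i : int) : divringClosed F :=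
  if odd `|i|%N then K1 else K0.

End Subfields.

Section SubgroupQuotient.
Variable V : zmodType.

Definition subgroup (P : V -> Prop) : Prop :=
  P 0 /\ (forall x y, P x -> P y -> P (x - y)).

Definition gen_subgroup (G : V -> Prop) (x : V) : Prop :=
  forall P : V -> Prop, subgroup P -> (forall y, G y -> P y) -> P x.

Lemma subgroup_gen (G : V -> Prop) : subgroup (gen_subgroup G).
Proof.
split=> [P [] //|x y Gx Gy P sP GP].
by case: (sP) => _; apply; [apply: Gx | apply: Gy].
Qed.

Variables (P : V -> Prop) (sP : subgroup P).

Definition subgroup_pred of subgroup P : {pred V} := fun x => `[< P x >].

Fact subgroup_pred_closed : zmod_closed (subgroup_pred sP).
Proof.
case: (sP) => P0 PB; split; first exact/asboolP.
by move=> x y /asboolP Px /asboolP Py; apply/asboolP/PB.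
Qed.

Definition subgroup_closed : zmodClosed V :=
  HB.pack (subgroup_pred sP)
    (GRing.isZmodClosed.Build V (subgroup_pred sP) subgroup_pred_closed).

Definition zquot : zmodType := Quotient.quot subgroup_closed.

Definition zproj (x : V) : zquot := \pi_(Quotient.quot subgroup_closed) x.

Definition zrepr (x : zquot) : V := repr (x : Quotient.quot subgroup_closed).

Lemma zprojB : {morph zproj : x y / x - y}.
Proof. exact: (raddfB \pi_(Quotient.quot subgroup_closed)). Qed.

Lemma zproj0 : zproj 0 = 0.
Proof. by rewrite -[X in zproj X](subrr 0) zprojB subrr. Qed.

Lemma zprojN : {morph zproj : x / - x}.
Proof. by move=> x; rewrite -sub0r zprojB zproj0 sub0r. Qed.

Lemma zprojD : {morph zproj : x y / x + y}.
Proof. by move=> x y; rewrite -[y]opprK zprojB zprojN !opprK. Qed.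

Lemma zreprK x : zproj (zrepr x) = x.
Proof. exact: reprK. Qed.

Lemma zproj_eq x y : zproj x = zproj y <-> P (x - y).
Proof.
have E : (zproj x == zproj y) = ((x - y) \in subgroup_pred sP).
  exact: esym (Quotient.idealrBE subgroup_closed x y).
by split=> [/eqP|Pxy]; [rewrite E => /asboolP | apply/eqP; rewrite E; apply/asboolP].
Qed.

End SubgroupQuotient.

(* Z-indexed algebras, with the homogeneous components zhom i j as data. *)
Record zalg := Zalg {
  zhom :> int -> int -> zmodType;
  zmul : forall i j l, zhom i j -> zhom j l -> zhom i l;
  zone : forall i, zhom i i;
  zmulDl : forall i j l (a b : zhom i j) (c : zhom j l),
    zmul (a + b) c = zmul a c + zmul b c;
  zmulDr : forall i j l (a : zhom i j) (b c : zhom j l),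
    zmul a (b + c) = zmul a b + zmul a c;
  zmulA : forall i j l m (a : zhom i j) (b : zhom j l) (c : zhom l m),
    zmul a (zmul b c) = zmul (zmul a b) c;
  zmul1l : forall i j (a : zhom i j), zmul (zone i) a = a;
  zmul1r : forall i j (a : zhom i j), zmul a (zone j) = a }.

Arguments zmul {z i j l}.
Arguments zone {z}.
Notation "a ** b" := (zmul a b) (at level 40, left associativity) : ring_scope.

Section Ideals.
Variable C : zalg.

Lemma zmul0r i j l (a : C i j) : a ** (0 : C j l) = 0.
Proof. by apply: (addrI (a ** 0)); rewrite -zmulDr !addr0. Qed.

Lemma zmul0l i j l (a : C j l) : (0 : C i j) ** a = 0.
Proof. by apply: (addrI (0 ** a)); rewrite -zmulDl !addr0. Qed.

Lemma zmulBr i j l (a : C i j) (b c : C j l) : a ** (b - c) = a ** b - a ** c.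
Proof. by apply: (addIr (a ** c)); rewrite -zmulDr !subrK. Qed.

Lemma zmulBl i j l (a b : C i j) (c : C j l) : (a - b) ** c = a ** c - b ** c.
Proof. by apply: (addIr (b ** c)); rewrite -zmulDl !subrK. Qed.

Definition two_sided_ideal (I : forall i j, C i j -> Prop) : Prop :=
  [/\ forall i j, subgroup (I i j),
      forall i j l (a : C i j) (b : C j l), I i j a -> I i l (a ** b)
    & forall i j l (a : C i j) (b : C j l), I j l b -> I i l (a ** b)].

Definition gen_ideal (d : int -> int) (x : forall i, C i (d i))
    i j (y : C i j) : Prop :=
  forall J : (forall i j, C i j -> Prop),
    two_sided_ideal J -> (forall i, J i (d i) (x i)) -> J i j y.

Lemma gen_ideal_two_sided (d : int -> int) (x : forall i, C i (d i)) :
  two_sided_ideal (gen_ideal x).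
Proof.
split=> [i j|i j l a b Ia J JI Jx|i j l a b Ib J JI Jx].
- split=> [J JI Jx|y z Iy Iz J JI Jx]; case: (JI) => /(_ i j)[J0 JB] _ _ //.
  by apply: JB; [apply: Iy | apply: Iz].
- by case: (JI) => _ + _; apply; apply: Ia.
- by case: (JI) => _ _; apply; apply: Ib.
Qed.

(* Elements of e_j C and C e_i are finitely supported families of components. *)
Definition fin_supp (V : int -> zmodType) (b : forall l, V l) : Prop :=
  exists s : seq int, forall l, l \notin s -> b l = 0.

Definition regular i j (a : C i j) : Prop :=
  (forall b : (forall l, C j l), fin_supp (V := C j) b ->
     (exists l, b l <> 0) -> exists l, a ** b l <> 0) /\
  (forall c : (forall l, C l i), fin_supp (V := C^~ i) c ->
     (exists l, c l <> 0) -> exists l, c l ** a <> 0).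

Definition right_free_rank1 (I : forall i j, C i j -> Prop) : Prop :=
  exists (d : int -> int) (a : forall i, C i (i + d i)),
    (forall i, regular (a i)) /\
    (forall i j (y : C i j), I i j y <-> exists c : C (i + d i) j, y = a i ** c).

Definition left_free_rank1 (I : forall i j, C i j -> Prop) : Prop :=
  exists (d : int -> int) (b : forall j, C (j - d j) j),
    (forall j, regular (b j)) /\
    (forall i j (y : C i j), I i j y <-> exists c : C i (j - d j), y = c ** b j).

Definition normal_family (d : int) (x : forall i, C i (i + d)) : Prop :=
  forall i j (y : C i (j + d)),
    (exists c : C (i + d) (j + d), y = x i ** c) <->
    (exists c : C i j, y = c ** x j).

End Ideals.

(* Multiplication need only be associative and unital modulo I, so that this
   also builds the tensor algebra out of free abelian groups on words. *)
Section GradedQuotient.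
Variables (V : int -> int -> zmodType).
Variables (m : forall i j l, V i j -> V j l -> V i l) (u : forall i, V i i).
Hypothesis mDl : forall i j l (a b : V i j) (c : V j l),
  m (a + b) c = m a c + m b c.
Hypothesis mDr : forall i j l (a : V i j) (b c : V j l),
  m a (b + c) = m a b + m a c.
Variable I : forall i j, V i j -> Prop.
Hypothesis Isub : forall i j, subgroup (@I i j).
Hypothesis Ir : forall i j l (a : V i j) (b : V j l), I a -> I (m a b).
Hypothesis Il : forall i j l (a : V i j) (b : V j l), I b -> I (m a b).
Hypothesis mA : forall i j l k (a : V i j) (b : V j l) (c : V l k),
  I (m a (m b c) - m (m a b) c).
Hypothesis m1l : forall i j (a : V i j), I (m (u i) a - a).
Hypothesis m1r : forall i j (a : V i j), I (m a (u j) - a).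

Definition gquot_hom i j : zmodType := zquot (Isub i j).

Definition gquot_proj i j (x : V i j) : gquot_hom i j := zproj (Isub i j) x.

Definition gquot_mul i j l (a : gquot_hom i j) (b : gquot_hom j l) :
  gquot_hom i l := gquot_proj (m (zrepr a) (zrepr b)).

Lemma gquot_projM i j l (a : V i j) (b : V j l) :
  gquot_mul (gquot_proj a) (gquot_proj b) = gquot_proj (m a b).
Proof.
apply/zproj_eq; set a' := zrepr _; set b' := zrepr _.
have Ha : I (a' - a) by apply/(zproj_eq (Isub _ _))/zreprK.
have Hb : I (b - b').
  by apply/(zproj_eq (Isub _ _)); rewrite zreprK.
have -> : m a' b' - m a b = m (a' - a) b' - m a (b - b').
  have -> : m (a' - a) b' = m a' b' - m a b'.
    by apply: (addIr (m a b')); rewrite -mDl !subrK.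
  have -> : m a (b - b') = m a b - m a b'.
    by apply: (addIr (m a b')); rewrite -mDr !subrK.
  by rewrite opprB addrA subrK.
by case: (Isub i l) => _ IB; apply: IB; [apply: Ir | apply: Il].
Qed.

Lemma gquot_projP i j (a : gquot_hom i j) : exists x : V i j, a = gquot_proj x.
Proof. by exists (zrepr a); rewrite /gquot_proj zreprK. Qed.

Fact gquot_mulDl i j l (a b : gquot_hom i j) (c : gquot_hom j l) :
  gquot_mul (a + b) c = gquot_mul a c + gquot_mul b c.
Proof.
have [x ->] := gquot_projP a; have [y ->] := gquot_projP b.
have [z ->] := gquot_projP c.
have -> : gquot_proj x + gquot_proj y = gquot_proj (x + y).
  by rewrite /gquot_proj zprojD.
by rewrite !gquot_projM mDl /gquot_proj zprojD.
Qed.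

Fact gquot_mulDr i j l (a : gquot_hom i j) (b c : gquot_hom j l) :
  gquot_mul a (b + c) = gquot_mul a b + gquot_mul a c.
Proof.
have [x ->] := gquot_projP a; have [y ->] := gquot_projP b.
have [z ->] := gquot_projP c.
have -> : gquot_proj y + gquot_proj z = gquot_proj (y + z).
  by rewrite /gquot_proj zprojD.
by rewrite !gquot_projM mDr /gquot_proj zprojD.
Qed.

Fact gquot_mulA i j l k
  (a : gquot_hom i j) (b : gquot_hom j l) (c : gquot_hom l k) :
  gquot_mul a (gquot_mul b c) = gquot_mul (gquot_mul a b) c.
Proof.
have [x ->] := gquot_projP a; have [y ->] := gquot_projP b.
have [z ->] := gquot_projP c.
by rewrite !gquot_projM; apply/zproj_eq/mA.
Qed.

Fact gquot_mul1l i j (a : gquot_hom i j) :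
  gquot_mul (gquot_proj (u i)) a = a.
Proof.
by have [x ->] := gquot_projP a; rewrite gquot_projM; apply/zproj_eq/m1l.
Qed.

Fact gquot_mul1r i j (a : gquot_hom i j) :
  gquot_mul a (gquot_proj (u j)) = a.
Proof.
by have [x ->] := gquot_projP a; rewrite gquot_projM; apply/zproj_eq/m1r.
Qed.

Definition gquot : zalg :=
  Zalg gquot_mulDl gquot_mulDr gquot_mulA gquot_mul1l gquot_mul1r.

End GradedQuotient.

Section QuotientAlgebra.
Variables (C : zalg) (I : forall i j, C i j -> Prop) (hI : two_sided_ideal I).

Fact ideal_subgroup i j : subgroup (@I i j).
Proof. by case: hI. Qed.

Fact ideal_mulr i j l (a : C i j) (b : C j l) : I a -> I (a ** b).
Proof. by case: hI => _ + _; apply. Qed.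

Fact ideal_mull i j l (a : C i j) (b : C j l) : I b -> I (a ** b).
Proof. by case: hI => _ _; apply. Qed.

Fact ideal_eq i j (a b : C i j) : a = b -> I (a - b).
Proof. by move->; rewrite subrr; case: (ideal_subgroup i j). Qed.

Definition quot_alg : zalg :=
  gquot (@zmulDl C) (@zmulDr C) ideal_subgroup ideal_mulr ideal_mull
    (fun i j l k a b c => ideal_eq (@zmulA C i j l k a b c))
    (fun i j a => ideal_eq (@zmul1l C i j a))
    (fun i j a => ideal_eq (@zmul1r C i j a)).

End QuotientAlgebra.

Section TensorAlgebra.
Variables (F : fieldType) (K0 K1 : divringClosed F).
Notation K := (subfield_mod2 K0 K1).

(* T i j is presented by generators and relations as an abelian group.  For
   i < j the generators are the words f_i ... f_(j-1), standing for the pure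
   tensors of j - i elements of F; for i = j they are the elements of K i, so
   that additivity alone gives back the group K i; there are none for i > j. *)
Definition is_word (i j : int) (s : seq F) : bool :=
  if i == j then (if s is [:: k] then k \in K i else false)
  else i + (size s)%:Z == j.

Definition word i j := {s : seq F | is_word i j s}.

Definition lscale (k : F) (s : seq F) : seq F :=
  if s is a :: s' then k * a :: s' else [::].

Definition rscale (s : seq F) (k : F) : seq F :=
  if s is a :: s' then rcons (belast a s') (last a s' * k) else [::].

Definition mul_seq (i j l : int) (s t : seq F) : seq F :=
  if i == j then lscale (head 0 s) t
  else if j == l then rscale s (head 0 t)
  else s ++ t.

Lemma mul_seqL i j l s t : i = j -> mul_seq i j l s t = lscale (head 0 s) t.
Proof. by rewrite /mul_seq => ->; rewrite eqxx. Qed.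

Lemma mul_seqR i j l s t :
  i != j -> j = l -> mul_seq i j l s t = rscale s (head 0 t).
Proof. by rewrite /mul_seq => /negPf-> ->; rewrite eqxx. Qed.

Lemma mul_seqC i j l s t : i != j -> j != l -> mul_seq i j l s t = s ++ t.
Proof. by rewrite /mul_seq => /negPf-> /negPf->. Qed.

Lemma size_lscale k s : size (lscale k s) = size s.
Proof. by case: s. Qed.

Lemma size_rscale s k : size (rscale s k) = size s.
Proof. by case: s => //= a s; rewrite size_rcons size_belast. Qed.

Lemma rscale_rcons s a k : rscale (rcons s a) k = rcons s (a * k).
Proof. by case: s => //= b s; rewrite last_rcons belast_rcons. Qed.

Lemma rscale_cat s t k : t != [::] -> rscale (s ++ t) k = s ++ rscale t k.
Proof.
case/lastP: t => // t a _.
by rewrite -rcons_cat !rscale_rcons rcons_cat.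
Qed.

Lemma lscale_cat s t k : s != [::] -> lscale k (s ++ t) = lscale k s ++ t.
Proof. by case: s. Qed.

Lemma lrscale s k l : lscale k (rscale s l) = rscale (lscale k s) l.
Proof. by case: s => //= a [|b s] //=; rewrite ?mulrA. Qed.

Lemma is_word_diag i s : is_word i i s -> exists2 k, s = [:: k] & k \in K i.
Proof. by rewrite /is_word eqxx; case: s => // k [] // Kk; exists k. Qed.

Lemma is_word_neq i j s : i != j -> is_word i j s = (i + (size s)%:Z == j).
Proof. by rewrite /is_word => /negPf->. Qed.

Lemma is_word_neq_nil i j s : is_word i j s -> s != [::].
Proof.
case: s => //; rewrite /is_word; case: eqVneq => //= ij.
by rewrite addr0 (negPf ij).
Qed.

Lemma is_word_lt i j l s t :
  i != j -> j != l -> is_word i j s -> is_word j l t -> i != l.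
Proof.
move=> ij jl; rewrite !is_word_neq // => /eqP Hs /eqP Ht.
by apply/eqP; move/eqP: ij; lia.
Qed.

Lemma mul_seqP i j l s t :
  is_word i j s -> is_word j l t -> is_word i l (mul_seq i j l s t).
Proof.
rewrite /mul_seq; have [-> {i}|ij] := eqVneq i j => Hs Ht.
  have [k -> Kk] := is_word_diag Hs => /=.
  have [jl|jl] := eqVneq j l.
    rewrite -jl in Ht *; have [k' -> Kk'] := is_word_diag Ht.
    by rewrite /is_word eqxx /= rpredM.
  by move: Ht; rewrite !is_word_neq // size_lscale.
have [jl|jl] := eqVneq j l.
  by rewrite -jl; move: Hs; rewrite !is_word_neq // size_rscale.
have il := is_word_lt ij jl Hs Ht.
move: Hs Ht; rewrite !is_word_neq // size_cat => /eqP Hs /eqP Ht.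
by apply/eqP; lia.
Qed.

Lemma word_diag i j (s : word i j) :
  i = j -> exists2 k, val s = [:: k] & k \in K i.
Proof. by move=> ij; case: j / ij s => s; apply/is_word_diag/(valP s). Qed.

Definition mul_word i j l (s : word i j) (t : word j l) : word i l :=
  Sub (mul_seq i j l (val s) (val t)) (mul_seqP (valP s) (valP t)).

Definition freeword i j : zmodType := {freeg (word i j) / int}.

Definition wgen i j (s : word i j) : freeword i j := << s >>.

Definition free_mul i j l (x : freeword i j) (y : freeword j l) : freeword i l :=
  fglift (fun s => fglift (fun t => wgen (mul_word s t) : {freeg (word i l) / int}) y) x.

(* Additivity in each slot, and balancing: the letter following a prefix p is
   separated from the next one by a tensor sign over K (i + size p + 1). *)
Inductive tensor_rel i j : freeword i j -> Prop :=
| tensor_rel_add p q a b (r s t : word i j) :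
    val r = p ++ (a + b) :: q -> val s = p ++ a :: q -> val t = p ++ b :: q ->
    tensor_rel (wgen r - wgen s - wgen t)
| tensor_rel_bal p q a b k (s t : word i j) :
    k \in K (i + (size p)%:Z + 1) ->
    val s = p ++ a * k :: b :: q -> val t = p ++ a :: k * b :: q ->
    tensor_rel (wgen s - wgen t).

Definition tensor_null i j : freeword i j -> Prop :=
  gen_subgroup (@tensor_rel i j).

Lemma freeword_ind i j (P : freeword i j -> Prop) :
  subgroup P -> (forall s, P (wgen s)) -> forall x, P x.
Proof.
move=> [P0 PB] Pg x.
have PN y : P y -> P (- y) by move=> Py; rewrite -sub0r; apply: PB.
have PD y z : P y -> P z -> P (y + z).
  by move=> Py Pz; rewrite -[z]opprK; apply: PB => //; apply: PN.
have PM y n : P y -> P (y *+ n).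
  by move=> Py; elim: n => // n IHn; rewrite mulrS; apply: PD.
rewrite -[x]freeg_sumE; elim/big_ind: _ => // s _.
have -> : << coeff s x *g s >> = wgen s *~ coeff s x.
  by rewrite /wgen freegU_mulz intz.
case: (coeff s x) => n; first exact: PM.
by rewrite NegzE mulrNz; apply/PN/PM.
Qed.

Fact free_mulE i j l (s : word i j) (t : word j l) :
  free_mul (wgen s) (wgen t) = wgen (mul_word s t).
Proof. by rewrite /free_mul /wgen !liftU !scale1r. Qed.

Fact free_mulBl i j l (a b : freeword i j) (c : freeword j l) :
  free_mul (a - b) c = free_mul a c - free_mul b c.
Proof. by rewrite /free_mul lift_is_additive. Qed.

Fact free_mul0l i j l (c : freeword j l) : free_mul (0 : freeword i j) c = 0.
Proof. by rewrite -[X in free_mul X](subrr 0) free_mulBl subrr. Qed.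

Fact free_mulDl i j l (a b : freeword i j) (c : freeword j l) :
  free_mul (a + b) c = free_mul a c + free_mul b c.
Proof. by apply: (addIr (- free_mul b c)); rewrite -free_mulBl !addrK. Qed.

Fact free_mulDr i j l (a : freeword i j) (b c : freeword j l) :
  free_mul a (b + c) = free_mul a b + free_mul a c.
Proof.
move: a; apply: freeword_ind; last first.
  move=> s; rewrite /free_mul /wgen !liftU !scale1r.
  set f := fglift _.
  have fB : {morph f : x y / x - y} by exact: lift_is_additive.
  have f0 : f 0 = 0 by rewrite -[X in f X](subrr 0) fB subrr.
  by rewrite -[c in LHS]opprK fB -[X in _ - f X]sub0r fB f0 sub0r opprK.
split=> [|x y Hx Hy]; first by rewrite !free_mul0l addr0.
by rewrite !free_mulBl Hx Hy opprD addrACA.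
Qed.

Fact free_mul0r i j l (a : freeword i j) : free_mul a (0 : freeword j l) = 0.
Proof. by apply: (addrI (free_mul a 0)); rewrite -free_mulDr !addr0. Qed.

Fact free_mulBr i j l (a : freeword i j) (b c : freeword j l) :
  free_mul a (b - c) = free_mul a b - free_mul a c.
Proof. by apply: (addIr (free_mul a c)); rewrite -free_mulDr !subrK. Qed.

Fact tensor_null_subgroup i j : subgroup (@tensor_null i j).
Proof. exact: subgroup_gen. Qed.

Lemma tensor_null_rel i j (x : freeword i j) : tensor_rel x -> tensor_null x.
Proof. by move=> Hx P _; apply. Qed.

Lemma nil_cons2 (p q : seq F) a k :
  p ++ a :: q = [:: k] -> [/\ p = [::], q = [::] & a = k].
Proof. by case: p => [|b [|c p]] //= [-> ->]. Qed.

Lemma subgroup_preim (U V : zmodType) (f : U -> V) (P : V -> Prop) :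
  f 0 = 0 -> {morph f : x y / x - y} -> subgroup P -> subgroup (P \o f).
Proof.
by move=> f0 fB [P0 PB]; split=> [|x y Px Py] /=; rewrite ?f0 ?fB //; apply: PB.
Qed.

Lemma tensor_rel_mulr i j l (x : freeword i j) (t : word j l) :
  tensor_rel x -> tensor_rel (free_mul x (wgen t)).
Proof.
case=> [p q a b r s u Er Es Eu|p q a b k r s Kk Er Es];
  rewrite !free_mulBl !free_mulE.
- have [ij|ij] := eqVneq i j.
    have [c Ec _] : exists2 c, val r = [:: c] & c \in K i.
      exact: word_diag ij.
    move: Ec; rewrite Er => /nil_cons2[Ep Eq _].
    have [d [t' Et]] : exists d t', val t = d :: t'.
      by move: (is_word_neq_nil (valP t)); case: (val t) => // d t' _; exists d, t'.
    apply: (@tensor_rel_add _ _ [::] t' (a * d) (b * d)); 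
      rewrite SubK mul_seqL // ?Er ?Es ?Eu Ep Eq Et /=; by rewrite ?mulrDl.
  have [jl|jl] := eqVneq j l.
    have [d Ed _] : exists2 d, val t = [:: d] & d \in K j.
      exact: word_diag jl.
    case/lastP: q Er Es Eu => [|q e] Er Es Eu.
      apply: (@tensor_rel_add _ _ p [::] (a * d) (b * d));
        rewrite SubK mul_seqR // ?Er ?Es ?Eu Ed /=;
        by rewrite cats1 rscale_rcons -cats1 ?mulrDl.
    apply: (@tensor_rel_add _ _ p (rcons q (e * d)) a b);
      rewrite SubK mul_seqR // ?Er ?Es ?Eu Ed /=;
      by rewrite -rcons_cons -rcons_cat rscale_rcons rcons_cat.
  apply: (@tensor_rel_add _ _ p (q ++ val t) a b);
    by rewrite SubK mul_seqC // ?Er ?Es ?Eu -catA.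
have [ij|ij] := eqVneq i j.
  have [c Ec _] : exists2 c, val r = [:: c] & c \in K i.
    exact: word_diag ij.
  by move: Ec; rewrite Er => /nil_cons2[].
have [jl|jl] := eqVneq j l.
  have [d Ed _] : exists2 d, val t = [:: d] & d \in K j.
    exact: word_diag jl.
  case/lastP: q Er Es => [|q e] Er Es.
    apply: (@tensor_rel_bal _ _ p [::] a (b * d) k) => //;
      rewrite SubK mul_seqR // ?Er ?Es Ed /=.
      by rewrite rscale_cat.
    by rewrite rscale_cat //= mulrA.
  apply: (@tensor_rel_bal _ _ p (rcons q (e * d)) a b k) => //;
    rewrite SubK mul_seqR // ?Er ?Es Ed /=;
    by rewrite -!rcons_cons -rcons_cat rscale_rcons rcons_cat.
apply: (@tensor_rel_bal _ _ p (q ++ val t) a b k) => //;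
  by rewrite SubK mul_seqC // ?Er ?Es -catA.
Qed.

Lemma tensor_rel_mull i j l (s : word i j) (x : freeword j l) :
  tensor_rel x -> tensor_rel (free_mul (wgen s) x).
Proof.
case=> [p q a b r t u Er Et Eu|p q a b k r t Kk Er Et];
  rewrite !free_mulBr !free_mulE.
- have [ij|ij] := eqVneq i j.
    have [c Ec _] : exists2 c, val s = [:: c] & c \in K i.
      exact: word_diag ij.
    case: p Er Et Eu => [|d p] Er Et Eu.
      apply: (@tensor_rel_add _ _ [::] q (c * a) (c * b));
        rewrite SubK mul_seqL // ?Er ?Et ?Eu Ec //=; by rewrite mulrDr.
    apply: (@tensor_rel_add _ _ (c * d :: p) q a b);
      by rewrite SubK mul_seqL // ?Er ?Et ?Eu Ec.
  have [jl|jl] := eqVneq j l.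
    have [d Ed _] : exists2 d, val r = [:: d] & d \in K j.
      exact: word_diag jl.
    move: Ed; rewrite Er => /nil_cons2[Ep Eq _].
    have [s' [c Ec]] : exists s' c, val s = rcons s' c.
      move: (is_word_neq_nil (valP s)).
      by case/lastP: (val s) => // s' c _; exists s', c.
    apply: (@tensor_rel_add _ _ s' [::] (c * a) (c * b));
      rewrite SubK mul_seqR // ?Er ?Et ?Eu Ep Eq Ec /=;
      by rewrite rscale_rcons cats1 ?mulrDr.
  apply: (@tensor_rel_add _ _ (val s ++ p) q a b);
    by rewrite SubK mul_seqC // ?Er ?Et ?Eu -catA.
have [ij|ij] := eqVneq i j.
  have [c Ec _] : exists2 c, val s = [:: c] & c \in K i.
    exact: word_diag ij.
  case: p Kk Er Et => [|d p] Kk Er Et.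
    apply: (@tensor_rel_bal _ _ [::] q (c * a) b k); rewrite ?ij //;
      by rewrite SubK mul_seqL // ?Er ?Et Ec //= mulrA.
  apply: (@tensor_rel_bal _ _ (c * d :: p) q a b k); rewrite ?ij //;
    by rewrite SubK mul_seqL // ?Er ?Et Ec.
have [jl|jl] := eqVneq j l.
  have [d Ed _] : exists2 d, val r = [:: d] & d \in K j.
    exact: word_diag jl.
  by move: Ed; rewrite Er => /nil_cons2[].
apply: (@tensor_rel_bal _ _ (val s ++ p) q a b k).
- move: (valP s); rewrite is_word_neq // => /eqP Hs.
  by rewrite size_cat PoszD addrA Hs.
- by rewrite SubK mul_seqC // Er -catA.
- by rewrite SubK mul_seqC // Et -catA.
Qed.

Fact tensor_null_mulr i j l (a : freeword i j) (b : freeword j l) :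
  tensor_null a -> tensor_null (free_mul a b).
Proof.
have sN := tensor_null_subgroup i l.
move=> Ha; move: b; apply: freeword_ind.
  by apply: (@subgroup_preim _ _ (fun x => free_mul a x) _ _ _ sN);
    [apply: free_mul0r | move=> x y; apply: free_mulBr].
move=> t; apply: (Ha (fun x => tensor_null (free_mul x (wgen t)))).
  by apply: (@subgroup_preim _ _ (fun x => free_mul x (wgen t)) _ _ _ sN);
    [apply: free_mul0l | move=> x y; apply: free_mulBl].
by move=> y Hy; apply: tensor_null_rel; apply: tensor_rel_mulr.
Qed.

Fact tensor_null_mull i j l (a : freeword i j) (b : freeword j l) :
  tensor_null b -> tensor_null (free_mul a b).
Proof.
have sN := tensor_null_subgroup i l.
move=> Hb; move: a; apply: freeword_ind.
  by apply: (@subgroup_preim _ _ (fun x => free_mul x b) _ _ _ sN);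
    [apply: free_mul0l | move=> x y; apply: free_mulBl].
move=> s; apply: (Hb (fun x => tensor_null (free_mul (wgen s) x))).
  by apply: (@subgroup_preim _ _ (fun x => free_mul (wgen s) x) _ _ _ sN);
    [apply: free_mul0r | move=> x y; apply: free_mulBr].
by move=> y Hy; apply: tensor_null_rel; apply: tensor_rel_mull.
Qed.

Fact is_word_unit i : is_word i i [:: 1].
Proof. by rewrite /is_word eqxx rpred1. Qed.

Definition unit_word i : word i i := Sub [:: 1] (is_word_unit i).

Lemma tensor_null_eq i j (s t : word i j) :
  val s = val t -> tensor_null (wgen s - wgen t).
Proof.
by move=> /val_inj->; rewrite subrr; case: (tensor_null_subgroup i j).
Qed.

Lemma mul_word_assoc i j l m (s : word i j) (t : word j l) (u : word l m) :
  tensor_null (wgen (mul_word s (mul_word t u)) - wgen (mul_word (mul_word s t) u)).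
Proof.
have [jl|jl] := eqVneq j l; last first.
  apply: tensor_null_eq; rewrite !SubK.
  have [ij|ij] := eqVneq i j.
    have il : i != l by rewrite ij.
    have [k -> Kk] := word_diag s ij.
    rewrite !(mul_seqL _ _ _ ij) /=; have [lm|lm] := eqVneq l m.
      by rewrite !mul_seqR // lrscale.
    by rewrite !mul_seqC // lscale_cat // (is_word_neq_nil (valP t)).
  have il := is_word_lt ij jl (valP s) (valP t).
  rewrite (mul_seqC _ _ ij jl); have [lm|lm] := eqVneq l m.
    have jm : j != m by rewrite -lm.
    rewrite (mul_seqC _ _ ij jm) (mul_seqR _ _ jl lm) (mul_seqR _ _ il lm).
    by rewrite rscale_cat // (is_word_neq_nil (valP t)).
  have jm := is_word_lt jl lm (valP t) (valP u).
  by rewrite !mul_seqC // catA.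
case: l / jl t u => t u.
have [k Et Kk] := is_word_diag (valP t).
have [jm|jm] := eqVneq j m.
  case: m / jm u => u; have [k' Eu Kk'] := is_word_diag (valP u).
  apply: tensor_null_eq; rewrite !SubK Et Eu (@mul_seqL j j) //=.
  have [ij|ij] := eqVneq i j.
    by rewrite !mul_seqL //=; case: (val s) => /= [|a s']; rewrite ?mul0r ?mulrA.
  rewrite !mul_seqR //=.
  by case/lastP: (val s) => //= s' a; rewrite !rscale_rcons mulrA.
have [ij|ij] := eqVneq i j.
  apply: tensor_null_eq; rewrite !SubK Et !mul_seqL //=.
  by case: (val u) => //= a u'; rewrite mulrA.
have Eu := valP u; have Es := valP s.
have [s' [c Ec]] : exists s' c, val s = rcons s' c.
  by move: (is_word_neq_nil Es); case/lastP: (val s) => // s' c _; exists s', c.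
have [d [u' Ed]] : exists d u', val u = d :: u'.
  by move: (is_word_neq_nil Eu); case: (val u) => // d u' _; exists d, u'.
set x := wgen _; set y := wgen _.
suff H : tensor_null (y - x).
  rewrite -opprB -sub0r; case: (tensor_null_subgroup i m) => N0 NB.
  exact: NB.
apply: tensor_null_rel; apply: (@tensor_rel_bal _ _ s' u' c d k).
- move: Es; rewrite is_word_neq // Ec size_rcons => /eqP Es.
  by rewrite -addrA -[1]/(1%N : int) -PoszD addn1 Es.
- rewrite !SubK (mul_seqC _ _ ij jm) mul_seqR // Ec Et Ed /=.
  by rewrite rscale_rcons cat_rcons.
rewrite !SubK (mul_seqC _ _ ij jm) mul_seqL // Ec Et Ed /=.
by rewrite cat_rcons.
Qed.

Fact free_mulA i j l m
  (a : freeword i j) (b : freeword j l) (c : freeword l m) :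
  tensor_null (free_mul a (free_mul b c) - free_mul (free_mul a b) c).
Proof.
have sN := tensor_null_subgroup i m.
have E (x y z t : freeword i m) : x - y - (z - t) = (x - z) - (y - t).
  by rewrite !opprB [t - z]addrC addrACA [- y + t]addrC.
move: a; apply: freeword_ind => [|s].
  apply: (@subgroup_preim _ _
    (fun a => free_mul a (free_mul b c) - free_mul (free_mul a b) c) _ _ _ sN).
    by rewrite !free_mul0l subrr.
  by move=> x y; rewrite !free_mulBl E.
move: b; apply: freeword_ind => [|t].
  apply: (@subgroup_preim _ _
    (fun b => free_mul (wgen s) (free_mul b c) - free_mul (free_mul (wgen s) b) c)
    _ _ _ sN).
    by rewrite !(free_mul0l, free_mul0r) subrr.
  by move=> x y; rewrite !(free_mulBl, free_mulBr) E.
move: c; apply: freeword_ind => [|u].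
  apply: (@subgroup_preim _ _
    (fun c => free_mul (wgen s) (free_mul (wgen t) c)
              - free_mul (free_mul (wgen s) (wgen t)) c) _ _ _ sN).
    by rewrite !free_mul0r subrr.
  by move=> x y; rewrite !free_mulBr E.
by rewrite !free_mulE; apply: mul_word_assoc.
Qed.

Fact free_mul1l i j (a : freeword i j) :
  tensor_null (free_mul (wgen (unit_word i)) a - a).
Proof.
suff -> : free_mul (wgen (unit_word i)) a = a.
  by rewrite subrr; case: (tensor_null_subgroup i j).
move: a; apply: freeword_ind => [|s].
  by split=> [|x y Hx Hy]; rewrite ?free_mul0r // free_mulBr Hx Hy.
rewrite free_mulE; congr wgen; apply: val_inj.
by rewrite SubK mul_seqL //=; case: (val s) => //= a t; rewrite mul1r.
Qed.

Fact free_mul1r i j (a : freeword i j) :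
  tensor_null (free_mul a (wgen (unit_word j)) - a).
Proof.
suff -> : free_mul a (wgen (unit_word j)) = a.
  by rewrite subrr; case: (tensor_null_subgroup i j).
move: a; apply: freeword_ind => [|s].
  by split=> [|x y Hx Hy]; rewrite ?free_mul0l // free_mulBl Hx Hy.
rewrite free_mulE; congr wgen; apply: val_inj.
rewrite SubK; have [ij|ij] := eqVneq i j.
  have [k -> Kk] : exists2 k, val s = [:: k] & k \in K i.
    exact: word_diag ij.
  by rewrite mul_seqL //= mulr1.
rewrite mul_seqR //=; case/lastP: (val s) => //= t a.
by rewrite rscale_rcons mulr1.
Qed.

Definition tensor_alg : zalg :=
  gquot free_mulDl free_mulDr tensor_null_subgroup
    tensor_null_mulr tensor_null_mull free_mulA free_mul1l free_mul1r.

Definition pure_tensor i j (s : word i j) : tensor_alg i j :=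
  gquot_proj tensor_null_subgroup (wgen s).

Fact is_word2 i (a b : F) : is_word i (i + 2) [:: a; b].
Proof.
by rewrite is_word_neq //=; apply/eqP; lia.
Qed.

Definition tensor2 i (a b : F) : tensor_alg i (i + 2) :=
  pure_tensor (Sub [:: a; b] (is_word2 i a b) : word i (i + 2)).

Variable w : int -> F.

Definition snc_rel i : tensor_alg i (i + 2) :=
  tensor2 i 1 1 + tensor2 i (w (i + 1))^-1 (w (i + 1)).

Definition snc : zalg := quot_alg (gen_ideal_two_sided snc_rel).

End TensorAlgebra.

(* Main.v *)
(* Let a_i, in degree (i, f i), and b_j, in degree (g j, j), be the right and
   left generators of I.  Nonvanishing of I_{ij} shows that f and g form a
   Galois connection on the integers.  If f i = f (i + 1) = j, then
   C_{m,m+1} a_{m+1} = a_m C_{jj} with m + 1 = g j, and since a_{m+1} C_{jj} =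
   C_{m+1,m+1} a_{m+1}, this would make C_{m,m+1} = F a line over C_{m+1,m+1} =
   K_{m+1}.  Hence f, and likewise g, is strictly monotone, so both are
   translations, mutually inverse; a_i and b_{f i} then differ by a unit, and
   the family a_i is normal.  Of S^nc(F) this uses only the components of
   degree at most 1, where the relations in degree 2 play no role. *)
Require Import Defs.
From mathcomp Require Import all_boot all_order all_algebra.
From mathcomp.multinomials Require Import freeg.
From mathcomp.classical Require Import boolp.
From mathcomp Require Import zify.

Set Implicit Arguments.
Unset Strict Implicit.
Unset Printing Implicit Defensive.

Import Order.TTheory GRing.Theory.
Local Open Scope ring_scope.

(** * Adjoint pairs of integer maps *)

Lemma int_homo_of_step (f : int -> int) :
  (forall i : int, (f i <= f (i + 1))%R) ->
  forall i k : int, (i <= k)%R -> (f i <= f k)%R.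
Proof.
move=> fS i k ik; have -> : k = i + (absz (k - i))%:Z by lia.
elim: (absz _) => [|n IHn]; first by rewrite addr0.
have -> : i + n.+1%:Z = i + n%:Z + 1 by lia.
exact: le_trans IHn (fS _).
Qed.

(** If [g (f i) > i], then [f (i + 1) <= f (g (f i)) <= f i], against strictness; so [g (f i) = i].
    A jump of [f] by at least 2 would force [g] to take two strict steps between [i] and [i + 1]. *)
Lemma int_adjoint_translation (f g : int -> int) :
  (forall i : int, (f i < f (i + 1))%R) ->
  (forall j : int, (g j < g (j + 1))%R) ->
  (forall i : int, (i <= g (f i))%R) -> (forall j : int, (f (g j) <= j)%R) ->
  forall i : int, f i = i + f 0 /\ g (f i) = i.
Proof.
move=> fS gS gf fg.
have fM := int_homo_of_step (fun i => ltW (fS i)).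
have gM := int_homo_of_step (fun j => ltW (gS j)).
have gfK (i : int) : g (f i) = i.
  have [/fM|] := leP (i + 1) (g (f i)); last by have := gf i; lia.
  by have := fS i; have := fg (f i); lia.
have fS1 (i : int) : f (i + 1) = f i + 1.
  have [/gM|] := leP (f i + 1 + 1) (f (i + 1)); last by have := fS i; lia.
  by have := gS (f i + 1); have := gS (f i); rewrite !gfK; lia.
move=> i; split=> //.
suff fn n : f n%:Z = n%:Z + f 0 /\ f (- n%:Z) = - n%:Z + f 0.
  by case: (fn (absz i)); case: (leP 0 i) => i0;
    [have -> : (absz i)%:Z = i by lia | have -> : - (absz i)%:Z = i by lia].
elim: n => [|n [IHp IHn]]; first by rewrite oppr0 !add0r.
have := fS1 n%:Z; have := fS1 (- (n.+1)%:Z).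
have -> : - n.+1%:Z + 1 = - n%:Z by lia.
have -> : n%:Z + 1 = n.+1%:Z by lia.
by rewrite IHp IHn; lia.
Qed.

(** * Ideals free of rank 1 in a Z-indexed algebra *)

Section FreeIdeals.
Variable C : zalg.

Definition cancellable i j (a : C i j) : Prop :=
  (forall l (c : C j l), a ** c = 0 -> c = 0) /\
  (forall l (c : C l i), c ** a = 0 -> c = 0).

Lemma fin_supp_dfwith (V : int -> zmodType) l (c : V l) :
  fin_supp (dfwith (fun l => 0 : V l) c).
Proof.
exists [:: l] => k; rewrite inE => kl.
by rewrite dfwith_out // eq_sym.
Qed.

(** Regularity is applied to families supported in a single degree, built with [dfwith]. *)
Lemma regular_cancellable i j (a : C i j) : regular a -> cancellable a.
Proof.
case=> ar al; split=> l c c0; apply/eqP; apply: contraT => /eqP cN0.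
  have [|k] := ar _ (fin_supp_dfwith (V := C j) c).
    by exists l; rewrite dfwith_in.
  by case: dfwithP => [|k' _]; rewrite ?zmul0r.
have [|k] := al _ (fin_supp_dfwith (V := C^~ i) c).
  by exists l; rewrite dfwith_in.
by case: dfwithP => [|k' _]; rewrite ?zmul0l.
Qed.

Variable I : forall i j, C i j -> Prop.

Definition right_gen i j (a : C i j) : Prop :=
  forall l (y : C i l), I y <-> exists c : C j l, y = a ** c.

Definition left_gen i j (b : C i j) : Prop :=
  forall l (y : C l j), I y <-> exists c : C l i, y = c ** b.

Lemma right_gen_mem i j (a : C i j) : right_gen a -> I a.
Proof. by move=> Ga; apply/Ga; exists (zone j); rewrite zmul1r. Qed.

Lemma left_gen_mem i j (b : C i j) : left_gen b -> I b.
Proof. by move=> Gb; apply/Gb; exists (zone i); rewrite zmul1l. Qed.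

Hypothesis idealI : two_sided_ideal I.

(** The interface to $S^{nc}(F)$: in degree 1, $F$ is larger than $K_i$ and $K_{i+1}$, so no single
    element generates $C_{i,i+1}$ on either side. *)
Hypothesis C_lt0 : forall i j (a : C i j), (j < i)%R -> a = 0.
Hypothesis C_diag : forall i (a : C i i), a <> 0 -> exists b, b ** a = zone i.
Hypothesis C_succ_r : forall i (phi : C i (i + 1)),
  exists psi, forall c : C (i + 1) (i + 1), psi <> phi ** c.
Hypothesis C_succ_l : forall i (phi : C i (i + 1)),
  exists psi, forall c : C i i, psi <> c ** phi.

Lemma succ_neq0 i : exists psi : C i (i + 1), psi <> 0.
Proof.
by have [psi /(_ 0)] := C_succ_r (0 : C i (i + 1)); rewrite zmul0l; exists psi.
Qed.

Lemma cancellable_neq0 i j (a : C i j) : cancellable a -> a <> 0.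
Proof.
move=> [ar _] a0; have [psi] := succ_neq0 j.
by apply; apply: ar; rewrite a0 zmul0l.
Qed.

Lemma neq0_le i j (a : C i j) : a <> 0 -> (i <= j)%R.
Proof. by move=> a0; rewrite leNgt; apply/negP => /(C_lt0 a). Qed.

Lemma neq0_mul i j l (a : C i j) (b : C j l) : a ** b <> 0 -> a <> 0 /\ b <> 0.
Proof. by move=> ab0; split=> E; apply: ab0; rewrite E ?zmul0l ?zmul0r. Qed.

(** Write $a = cb$; then $c \in C_{ii}$ is nonzero, hence has a left inverse $c'$, and $b = c'a$. *)
Lemma left_gen_of_right_gen i j (a b : C i j) :
  cancellable a -> right_gen a -> left_gen b -> left_gen a.
Proof.
move=> /cancellable_neq0 a0 Ga Gb l y.
have /Gb[c Ea] := right_gen_mem Ga.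
have [c' c'c] : exists c', c' ** c = zone i.
  by apply: C_diag; move: a0; rewrite Ea => /neq0_mul[].
split=> [/Gb[d ->]|[d ->]]; last first.
  by case: idealI => _ _; apply; apply: right_gen_mem.
by exists (d ** c'); rewrite Ea zmulA -(zmulA d) c'c zmul1r.
Qed.


Lemma right_gen_le i j l (a : C i j) (y : C i l) :
  right_gen a -> I y -> y <> 0 -> (j <= l)%R.
Proof. by move=> Ga /Ga[c ->] /neq0_mul[_ /neq0_le]. Qed.

Lemma left_gen_le i j l (b : C i j) (y : C l j) :
  left_gen b -> I y -> y <> 0 -> (l <= i)%R.
Proof. by move=> Gb /Gb[c ->] /neq0_mul[/neq0_le]. Qed.

(* With a' = phi ** a, such generators would give C_{i,i+1} a = a' C_{jj}
   = phi a C_{jj} = phi C_{i+1,i+1} a, hence C_{i,i+1} = phi C_{i+1,i+1}. *)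
Lemma right_gen_succ i j (a : C (i + 1) j) (a' : C i j) :
  cancellable a -> right_gen a -> left_gen a -> right_gen a' -> False.
Proof.
case: idealI => _ Ir Il [_ al] Ga La Ga'.
have /La[phi Ephi] := right_gen_mem Ga'.
have [psi psiN] := C_succ_r phi.
have /Ga'[c Ec] : I (psi ** a) by apply: Il; apply: right_gen_mem.
have /La[k Ek] : I (a ** c) by apply: Ir; apply: right_gen_mem.
apply: (psiN k); apply/subr0_eq/al.
by rewrite zmulBl Ec Ephi -!zmulA Ek subrr.
Qed.

(** Mirror image: with $b = a\phi$, one gets $a\psi = cb = ca\phi = ak\phi$; cancelling $a$ shows
    that $\phi$ generates $C_{j,j+1}$ on the left. *)
Lemma left_gen_succ i j (a : C i j) (b : C i (j + 1)) :
  cancellable a -> right_gen a -> left_gen a -> left_gen b -> False.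
Proof.
case: idealI => _ Ir Il [ar _] Ga La Gb.
have /Ga[phi Ephi] := left_gen_mem Gb.
have [psi psiN] := C_succ_l phi.
have /Gb[c Ec] : I (a ** psi) by apply: Ir; apply: right_gen_mem.
have /Ga[k Ek] : I (c ** a) by apply: Il; apply: right_gen_mem.
apply: (psiN k); apply/subr0_eq/ar.
by rewrite zmulBr Ec Ephi !zmulA Ek subrr.
Qed.

(** * The degree maps of the generators *)

Variables f g : int -> int.
Hypothesis genf : forall i, exists a : C i (f i), cancellable a /\ right_gen a.
Hypothesis geng : forall j, exists b : C (g j) j, cancellable b /\ left_gen b.

(** The nonzero generator $a_i$ is a left multiple of $b_{f(i)}$, with a factor in
    $C_{i,g(f(i))}$. *)
Lemma gen_gf (i : int) : (i <= g (f i))%R.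
Proof.
have [a [/cancellable_neq0 a0 Ga]] := genf i; have [b [_ Gb]] := geng (f i).
exact: (left_gen_le Gb (right_gen_mem Ga)).
Qed.

Lemma gen_fg (j : int) : (f (g j) <= j)%R.
Proof.
have [a [_ Ga]] := genf (g j); have [b [/cancellable_neq0 b0 Gb]] := geng j.
exact: (right_gen_le Ga (left_gen_mem Gb)).
Qed.

(** For $\psi \ne 0$ in $C_{i,i+1}$, the product $\psi a_{i+1}$ is a nonzero element of $I$, hence a
    right multiple of $a_i$. *)
Lemma gen_f_homo (i k : int) : (i <= k)%R -> (f i <= f k)%R.
Proof.
apply: int_homo_of_step => {i k} i.
have [a [_ Ga]] := genf i; have [a' [[_ a'l] Ga']] := genf (i + 1).
have [psi psi0] := succ_neq0 i.
apply: (right_gen_le Ga (y := psi ** a')) => [|/a'l //].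
by case: idealI => _ _; apply; apply: right_gen_mem.
Qed.

Lemma gen_g_homo (i k : int) : (i <= k)%R -> (g i <= g k)%R.
Proof.
apply: int_homo_of_step => {i k} j.
have [b [[br _] Gb]] := geng j; have [b' [_ Gb']] := geng (j + 1).
have [psi psi0] := succ_neq0 j.
apply: (left_gen_le Gb' (y := b ** psi)) => [|/br //].
by case: idealI => _ + _; apply; apply: left_gen_mem.
Qed.

Lemma gen_f_lt (i : int) : (f i < f (i + 1))%R.
Proof.
rewrite lt_neqAle gen_f_homo ?andbT; last by lia.
apply/eqP => Ef; have [j Ej] : exists j, f i = j by exists (f i).
have Ej1 : f (i + 1) = j by rewrite -Ef.
(* By adjunction [f] is constant on $[i, g(j)]$; at its last two indices $m, m+1$, the generators
   $b_j$ and $a_{m+1}$ share the degree $(m+1, j)$. *)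
have [m Em] : exists m, g j = m + 1 by exists (g j - 1); lia.
have im : (i <= m)%R by have := gen_gf (i + 1); rewrite Ej1 Em; lia.
have fm : f m = j /\ f (m + 1) = j.
  have := gen_fg j; rewrite Em.
  have := gen_f_homo im; have := @gen_f_homo m (m + 1) ltac:(lia).
  have := @gen_f_homo (i + 1) (m + 1) ltac:(lia); rewrite Ej Ej1; lia.
have [a' [_ Ga']] := genf m; have [a [ca Ga]] := genf (m + 1).
have [b [_ Gb]] := geng j; rewrite Em in b Gb.
(* The generators are generalised first so that rewriting [f m] and [f (m + 1)] reaches their
   types. *)
case: fm a' Ga' a ca Ga => -> -> a' Ga' a ca Ga.
exact: right_gen_succ ca Ga (left_gen_of_right_gen ca Ga Gb) Ga'.
Qed.

Lemma gen_g_lt (j : int) : (g j < g (j + 1))%R.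
Proof.
rewrite lt_neqAle gen_g_homo ?andbT; last by lia.
apply/eqP => Eg; have [i Ei] : exists i, g j = i by exists (g j).
have Ei1 : g (j + 1) = i by rewrite -Eg.
(* Here [g] is constant on $[f(i), j+1]$; at its first two indices $m, m+1$, the generators $a_i$
   and $b_m$ share the degree $(i, m)$. *)
have [m Em] : exists m, f i = m by exists (f i).
have mj : (m + 1 <= j + 1)%R by have := gen_fg j; rewrite Ei Em; lia.
have gm : g m = i /\ g (m + 1) = i.
  have := gen_gf i; rewrite Em.
  have := gen_g_homo mj; have := @gen_g_homo m (m + 1) ltac:(lia).
  by rewrite Ei1; lia.
have [b' [_ Gb']] := geng (m + 1); have [b [_ Gb]] := geng m.
have [a [ca Ga]] := genf i; rewrite Em in a ca Ga.
case: gm b' Gb' b Gb => -> -> b' Gb' b Gb.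
exact: left_gen_succ ca Ga (left_gen_of_right_gen ca Ga Gb) Gb'.
Qed.

Lemma free_ideal_normal :
  exists (d : int) (x : forall i, C i (i + d)),
    normal_family x /\ forall i j (y : C i j), I y <-> gen_ideal x y.
Proof.
have fg := int_adjoint_translation gen_f_lt gen_g_lt gen_gf gen_fg.
exists (f 0).
have gen i : exists a : C i (i + f 0), right_gen a /\ left_gen a.
  have [a [ca Ga]] := genf i; have [b [_ Gb]] := geng (f i).
  (* Since $g(f(i)) = i$, the generators $a_i$ and $b_{f(i)}$ have the same degree. *)
  have [fE gE] := fg i; rewrite gE in b Gb.
  have La := left_gen_of_right_gen ca Ga Gb.
  by move: (f i) fE a {ca b gE Gb} Ga La => _ -> a Ga La; exists a.
pose x i := sval (cid (gen i)).
have Gx i : right_gen (x i) by rewrite /x; case: cid => a [].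
have Lx i : left_gen (x i) by rewrite /x; case: cid => a [].
exists x; split=> i j y.
  (* Both sides of normality describe $I_{i,j+d}$. *)
  by split=> [/Gx/Lx|/Lx/Gx].
split=> [/Gx[c ->] J [_ Jr _] Jx|]; first exact/Jr/Jx.
by apply=> // k; apply: right_gen_mem.
Qed.

End FreeIdeals.

(** * Quotient maps and low degrees of the tensor algebra *)

Lemma quot_projM (C : zalg) (J : forall i j, C i j -> Prop)
    (hJ : two_sided_ideal J) i j l (a : C i j) (b : C j l) :
  (gquot_proj (ideal_subgroup hJ) a : quot_alg hJ i j) **
    (gquot_proj (ideal_subgroup hJ) b : quot_alg hJ j l)
    = gquot_proj (ideal_subgroup hJ) (a ** b).
Proof.
apply: gquot_projM; [exact: zmulDl | exact: zmulDr | |].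
  exact: ideal_mulr hJ.
exact: ideal_mull hJ.
Qed.

Section TensorAlgebraLowDegree.
Variables (F : fieldType) (K0 K1 : divringClosed F).
Notation K := (subfield_mod2 K0 K1).
Notation T := (tensor_alg K0 K1).

Lemma pure_tensorM i j l (s : word K0 K1 i j) (t : word K0 K1 j l) :
  pure_tensor s ** pure_tensor t = pure_tensor (mul_word s t).
Proof.
rewrite /pure_tensor -free_mulE; apply: gquot_projM.
- exact: free_mulDl.
- exact: free_mulDr.
- exact: tensor_null_mulr.
exact: tensor_null_mull.
Qed.

Lemma tensor_lt0 i j (a : T i j) : (j < i)%R -> a = 0.
Proof.
move=> ji; have [x ->] := gquot_projP a.
suff -> : x = 0 by rewrite /gquot_proj zproj0.
move: x; apply: freeword_ind; first by split=> // x y -> ->; rewrite subrr.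
case=> s ps; exfalso; move: ps; rewrite /is_word.
by case: (i =P j) => [|_ /eqP]; lia.
Qed.

(** The additivity relation for $a = (a-b)+b$. *)
Lemma pure_tensorB i j (r s t : word K0 K1 i j) a b :
  val r = [:: a - b] -> val s = [:: a] -> val t = [:: b] ->
  pure_tensor r = pure_tensor s - pure_tensor t.
Proof.
move=> Er Es Et; rewrite /pure_tensor /gquot_proj -zprojB.
apply/esym/zproj_eq; apply: tensor_null_rel; rewrite addrAC.
by apply: (@tensor_rel_add _ _ _ _ _ [::] [::] (a - b) b s r t); rewrite ?subrK.
Qed.

Lemma word1_succ i (a : F) : is_word K0 K1 i (i + 1) [:: a].
Proof. by rewrite is_word_neq //=; apply/eqP; lia. Qed.

Definition word1 i (a : F) : word K0 K1 i (i + 1) :=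
  Sub [:: a] (word1_succ i a).

(** In degrees 0 and 1 the classes of one-letter words already form a subgroup, so sums collapse to
    a single word. *)
Lemma tensor1P i j (x : T i j) : (i <= j)%R -> (j <= i + 1)%R ->
  exists (s : word K0 K1 i j) a, val s = [:: a] /\ x = pure_tensor s.
Proof.
move=> ij ji; have [z ->] := gquot_projP x; move: z => {x}.
have w0 : is_word K0 K1 i j [:: 0].
  by rewrite /is_word rpred0; case: (i =P j) => // ijN; apply/eqP => /=; lia.
apply: freeword_ind => [|s]; last first.
  have [a Es] : exists a, val s = [:: a].
    have := valP s; rewrite /is_word.
    case: (val s) => [|a [|b s']]; first by case: (i =P j) => //= ijN /eqP; lia.
      by exists a.
    by case: (i =P j) => //= ijN /eqP; lia.
  by exists s, a.
split=> [|x y [s [a [Es Ex]]] [t [b [Et Ey]]]].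
  exists (Sub [:: 0] w0), 0; split=> //.
  have := @pure_tensorB _ _ (Sub [:: 0] w0) (Sub [:: 0] w0) (Sub [:: 0] w0) 0 0.
  by rewrite SubK !subrr /gquot_proj zproj0 => ->.
have wB : is_word K0 K1 i j [:: a - b].
  have := valP s; have := valP t; rewrite Es Et /is_word.
  by case: (i =P j) => // _ bK aK; rewrite rpredB.
exists (Sub [:: a - b] wB), (a - b); split=> //.
by rewrite /gquot_proj zprojB (pure_tensorB _ Es Et) -?Ex -?Ey.
Qed.

Lemma size_word1 i (s : word K0 K1 i (i + 1)) : size (val s) = 1%N.
Proof.
by have := valP s; rewrite is_word_neq => [/eqP|]; [|apply/eqP]; lia.
Qed.

(** Sending a one-letter word to its letter extends additively and kills the relations, so it
    separates letters in $T_{i,i+1}$. *)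
Lemma tensor1_inj i (a b : F) :
  pure_tensor (word1 i a) = pure_tensor (word1 i b) -> a = b.
Proof.
move=> /zproj_eq Nab.
(* [zmodule F] is $F$ viewed as a module over the integers, for use with [fglift]. *)
pose ev (x : freeword K0 K1 i (i + 1)) : zmodule F :=
  fglift (fun s : word K0 K1 i (i + 1) => head 0 (val s) : zmodule F) x.
have evB : {morph ev : x y / x - y} by exact: lift_is_additive.
have ev0 : ev 0 = 0 by rewrite -[X in ev X](subrr 0) evB subrr.
have evE s : ev (wgen s) = head 0 (val s) by rewrite /ev /wgen liftU scale1r.
suff : ev (wgen (word1 i a) - wgen (word1 i b)) = 0.
  by rewrite evB !evE /= => /subr0_eq.
apply: (Nab (fun x => ev x = 0)).
  by split=> // x y Ex Ey; rewrite evB Ex Ey subrr.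
move=> y [p q c d r s t Er Es Et|p q c d k s t _ Es Et].
  have := size_word1 r; rewrite Er size_cat /=.
  case: p Er Es Et => [|e p] Er Es Et; last by rewrite addSn addnS.
  by rewrite !evB !evE Er Es Et /= addrAC addrK subrr.
(* A balancing relation needs two letters. *)
by have := size_word1 s; rewrite Es size_cat /= !addnS.
Qed.

(* This ideal contains the relations h_i. *)
Lemma low_degree_ideal :
  two_sided_ideal (fun i j (x : T i j) => (j <= i + 1)%R -> x = 0).
Proof.
split=> [i j|i j l a b a0 li|i j l a b b0 li].
- by split=> // x y x0 y0 ji; rewrite x0 // y0 // subrr.
- have [lj|jl] := ltP l j; first by rewrite (tensor_lt0 b) // zmul0r.
  by rewrite a0 ?zmul0l //; apply: le_trans jl li.
- have [ji|ij] := ltP j i; first by rewrite (tensor_lt0 a) // zmul0l.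
  by rewrite b0 ?zmul0r //; lia.
Qed.

(** * Low degrees of $S^{nc}(F)$ *)

Variable w : int -> F.
Hypothesis w_notin : forall i : int, w i \notin K i.
Notation S := (snc K0 K1 w).
Notation Rsub := (ideal_subgroup (gen_ideal_two_sided (snc_rel K0 K1 w))).
Notation proj := (gquot_proj Rsub).

Lemma snc_lt0 i j (a : S i j) : (j < i)%R -> a = 0.
Proof.
move=> ji; have [x ->] := gquot_projP a.
by rewrite (tensor_lt0 x) // /gquot_proj zproj0.
Qed.

Lemma snc1P i (x : S i (i + 1)) : exists a, x = proj (pure_tensor (word1 i a)).
Proof.
have [t ->] := gquot_projP x.
have [||s [a [Es ->]]] := tensor1P t; try by lia.
by exists a; congr (proj (pure_tensor _)); apply: val_inj.
Qed.

(** Each $h_k$ has degree 2, so $R$ lies in the ideal of elements vanishing in degrees at most 1,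
    and nothing is divided out of $T_{i,i+1}$. *)
Lemma snc1_inj i (a b : F) :
  proj (pure_tensor (word1 i a)) = proj (pure_tensor (word1 i b)) -> a = b.
Proof.
move=> /zproj_eq Rab; apply: (@tensor1_inj i); apply: subr0_eq.
by apply: (Rab _ low_degree_ideal) => // k; lia.
Qed.

Lemma snc_diagP i (x : S i i) :
  exists (s : word K0 K1 i i) k,
    [/\ val s = [:: k], k \in K i & x = proj (pure_tensor s)].
Proof.
have [t ->] := gquot_projP x.
have [||s [a [Es ->]]] := tensor1P t; try by lia.
by exists s, a; split=> //; have := valP s; rewrite Es /is_word eqxx.
Qed.

Lemma snc_mul i j l (s : word K0 K1 i j) (t : word K0 K1 j l) :
  (proj (pure_tensor s) : S i j) ** (proj (pure_tensor t) : S j l)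
    = proj (pure_tensor (mul_word s t)).
Proof.
by rewrite quot_projM pure_tensorM.
Qed.

Lemma snc_diag_inv i (x : S i i) : x <> 0 -> exists y : S i i, y ** x = zone i.
Proof.
have [s [k [Es kK ->]]] := snc_diagP x; move=> s0.
have k0 : k != 0.
  apply/eqP => k0; apply: s0; rewrite k0 in Es.
  by rewrite (@pure_tensorB _ _ s s s 0 0) ?subrr ?Es // /gquot_proj zproj0.
have wV : is_word K0 K1 i i [:: k^-1] by rewrite /is_word eqxx rpredV.
exists (proj (pure_tensor (Sub [:: k^-1] wV))); rewrite snc_mul.
congr (proj (gquot_proj _ (wgen _))); apply: val_inj.
by rewrite /= mul_seqL // Es /= mulVf.
Qed.

(** If $F = fK_{i+1}$, then $1$ and $w_{i+1}$ are both $K_{i+1}$-multiples of $f$, so their quotient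
    $w_{i+1}$ lies in $K_{i+1}$. *)
Lemma snc_succ_r i (phi : S i (i + 1)) :
  exists psi, forall c : S (i + 1) (i + 1), psi <> phi ** c.
Proof.
have [f ->] := snc1P phi.
apply: contrapT => /forallNP Hf.
have {}Hf a : exists2 k, k \in K (i + 1) & a = f * k.
  have /existsNP[c] := Hf (proj (pure_tensor (word1 i a))).
  have [s [k [Es kK ->]]] := snc_diagP c; move/contrapT.
  rewrite snc_mul => E; exists k => //; apply: (@snc1_inj i); rewrite E.
  congr (proj (pure_tensor _)); apply: val_inj.
  by rewrite /= mul_seqR /= ?Es //; apply/eqP; lia.
have [k kK f1] := Hf 1; have [k' k'K fw] := Hf (w (i + 1)).
have /negP[] := w_notin (i + 1).
have k0 : k != 0.
  by apply/eqP => k0; move/eqP: f1; rewrite k0 mulr0 oner_eq0.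
by rewrite fw -[f](mulfK k0) -f1 mul1r rpredM // rpredV.
Qed.

(** The same argument with $w_i$ and $K_i$ acting on the left. *)
Lemma snc_succ_l i (phi : S i (i + 1)) :
  exists psi, forall c : S i i, psi <> c ** phi.
Proof.
have [f ->] := snc1P phi.
apply: contrapT => /forallNP Hf.
have {}Hf a : exists2 k, k \in K i & a = k * f.
  have /existsNP[c] := Hf (proj (pure_tensor (word1 i a))).
  have [s [k [Es kK ->]]] := snc_diagP c; move/contrapT.
  rewrite snc_mul => E; exists k => //; apply: (@snc1_inj i); rewrite E.
  congr (proj (pure_tensor _)); apply: val_inj.
  by rewrite /= mul_seqL //= Es.
have [k kK f1] := Hf 1; have [k' k'K fw] := Hf (w i).
have /negP[] := w_notin i.
have k0 : k != 0.
  by apply/eqP => k0; move/eqP: f1; rewrite k0 mul0r oner_eq0.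
by rewrite fw -[f](mulKf k0) -f1 mulr1 rpredM // rpredV.
Qed.

End TensorAlgebraLowDegree.


Theorem theorem1p3 (F : fieldType) (K0 K1 : divringClosed F)
  (charF : 2%N \notin [pchar F])
  (index_K0 : index2 K0) (index_K1 : index2 K1)
  (simpleF : simple_bimodule K0 K1)
  (w : int -> F)
  (w_notin : forall i : int, w i \notin subfield_mod2 K0 K1 i)
  (w_sqr : forall i : int, w i ^+ 2 \in subfield_mod2 K0 K1 i)
  (I : forall i j : int, snc K0 K1 w i j -> Prop)
  (ideal_I : two_sided_ideal I)
  (right_free_I : right_free_rank1 I)
  (left_free_I : left_free_rank1 I) :
  exists (d : int) (x : forall i : int, snc K0 K1 w i (i + d)),
    normal_family x /\
    (forall (i j : int) (y : snc K0 K1 w i j), I i j y <-> gen_ideal x y).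
Proof.
have [d [a [ra Ga]]] := right_free_I; have [e [b [rb Gb]]] := left_free_I.
(* The degrees of $a_i \in C_{i,i+d_i}$ and $b_j \in C_{j-e_j,j}$ give the maps [f] and [g]. *)
apply: (@free_ideal_normal _ _ ideal_I _ _ _ _
  (fun i => i + d i) (fun j => j - e j)).
- exact: snc_lt0.
- exact: snc_diag_inv.
- exact: snc_succ_r w_notin.
- exact: snc_succ_l w_notin.
- by move=> i; exists (a i); split; [apply: regular_cancellable | apply: Ga].
- by move=> j; exists (b j); split;
    [apply: regular_cancellable | move=> l; apply: Gb].
Qed.
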